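(* Let $\mathbf{L}_M=\mathbf{M}^{-1/2}\mathbf{L}\mathbf{M}^{-1/2}$ be the inertia-scaled $S\times S$ Laplacian matrix described in the context, with eigenvalues $0=\lambda_1<\lambda_2\le\dots\le\lambda_S$, let $\gamma>0$, let $K$ be an integer with $1\le K\le S-1$, and let $$f_y(\mathbf{L}_M)=\frac{1}{2\gamma}\sum_{i=2}^{K+1}\frac{1}{\lambda_i},$$ that is, $\frac{1}{2\gamma}$ times the sum of the $K$ largest eigenvalues of the Moore–Penrose pseudoinverse $\mathbf{L}_M^\dagger$. Then $f_y(\mathbf{L}_M)$ is the optimal value of the semidefinite program $$f_y(\mathbf{L}_M)=\min_{s\in\mathbb{R},\ \mathbf{Z}\succeq 0}\ \frac{\operatorname{Tr}(\mathbf{Z})+Ks}{2\gamma}\qquad\text{subject to}\qquad \begin{bmatrix}\mathbf{Z}+s\mathbf{I}_S & \mathbf{W}\\ \mathbf{W} & \mathbf{L}_M\end{bmatrix}\succeq 0,$$ where $\mathbf{Z}$ ranges over real symmetric positive semidefinite $S\times S$ matrices, $\mathbf{W}:=\mathbf{I}_S-\mathbf{u}_1\mathbf{u}_1^\top$, and $\mathbf{u}_1:=(\mathbf{1}^\top\mathbf{M}\mathbf{1})^{-1/2}\,\mathbf{M}^{1/2}\mathbf{1}$.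
   Context: Let $S\ge 2$ be the number of synchronous buses of a power network. $\mathbf{M}$ is an $S\times S$ diagonal matrix with strictly positive diagonal entries $M_1,\dots,M_S$ (inertia constants). $\mathbf{L}$ is the $S\times S$ symmetric matrix with entries $$[\mathbf{L}]_{n,m}=-\frac{E_nE_m}{\gamma_{nm}}\cos(\bar\delta_n-\bar\delta_m)\ \ (n\ne m),\qquad [\mathbf{L}]_{n,n}=\sum_{k\ne n}\frac{E_nE_k}{\gamma_{nk}}\cos(\bar\delta_n-\bar\delta_k),$$ where $E_n>0$ are voltage magnitudes, $\gamma_{nm}=\gamma_{mn}>0$ are effective reactances, and the equilibrium angles $\bar\delta_n\in\mathbb{R}$ satisfy $|\bar\delta_n-\bar\delta_m|<\pi/2$ for all $n\neq m$. Thus $\mathbf{L}$ is a weighted graph Laplacian with positive edge weights. The number $\gamma>0$ is the common ratio of damping to inertia: the damping matrix is $\mathbf{D}=\gamma\mathbf{M}$ in the linearized swing dynamics $\mathbf{M}\ddot{\boldsymbol\delta}+\mathbf{D}\dot{\boldsymbol\delta}+\mathbf{L}\boldsymbol\delta=\mathbf{p}$. Write $\mathbf{L}_M=\mathbf{U}\boldsymbol\Lambda\mathbf{U}^\top$ with $\mathbf{U}$ orthonormal and $\boldsymbol\Lambda=\operatorname{diag}(\lambda_1,\dots,\lambda_S)$, where the eigenvalues are sorted as $0=\lambda_1<\lambda_2\le\dots\le\lambda_S$. The set $\mathcal{E}$ of low-frequency modes of interest consists of the $K$ eigensystems with the smallest nonzero eigenvalues, i.e. $\mathcal{E}=\{2,\dots,K+1\}$.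 The stability metric is $f_y=\frac{1}{2\gamma}\operatorname{Tr}(\boldsymbol\Lambda_{\mathcal{E}}^{-1})$, where $\boldsymbol\Lambda_{\mathcal{E}}$ is the diagonal matrix of the eigenvalues $\lambda_i$, $i\in\mathcal{E}$. (It arises as the sum over $i\in\mathcal{E}$ of the stationary variances $\frac{1}{2\gamma\lambda_i}$ of the modes $\ddot y_i+\gamma\dot y_i+\lambda_iy_i=x_i$ driven by mutually uncorrelated unit-intensity white noises $x_i$.) $\mathbf{1}$ is the all-ones vector in $\mathbb{R}^S$, $\mathbf{I}_S$ is the $S\times S$ identity, $\succeq 0$ denotes positive semidefiniteness of a real symmetric matrix, and $\dagger$ denotes the Moore–Penrose pseudoinverse. *)

(* Defs.v *)
From mathcomp Require Import all_boot all_order all_algebra.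
From mathcomp Require Import all_classical all_reals all_analysis.

Set Implicit Arguments.
Unset Strict Implicit.
Unset Printing Implicit Defensive.

Import Order.TTheory GRing.Theory Num.Theory.
Local Open Scope classical_set_scope.
Local Open Scope ring_scope.

Section MatrixNotions.
Context {R : realType}.

(* Loewner order: the quadratic form of a *symmetric* matrix is nonnegative. *)
Definition psd n (A : 'M[R]_n) : Prop :=
  A^T = A /\ forall x : 'cV[R]_n, 0 <= (x^T *m A *m x) 0 0.

(* All eigenvalues of A, with algebraic multiplicity, in nondecreasing order:
   the unique sorted list s such that the characteristic polynomial is the
   product of the 'X - x for x in s.  It is the dummy value [::] when that
   polynomial does not split over R, which does not happen for symmetric A. *)
Definition eigvals n (A : 'M[R]_n) : seq R :=
  xget [::] [set s : seq R |
    sorted (fun x y : R => x <= y) s /\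
    char_poly A = \prod_(x <- s) ('X - x%:P)].

Definition penrose n (A X : 'M[R]_n) : Prop :=
  [/\ A *m X *m A = A,
      X *m A *m X = X,
      (A *m X)^T = A *m X &
      (X *m A)^T = X *m A].

Definition mp_pinv n (A : 'M[R]_n) : 'M[R]_n :=
  xget 0 [set X : 'M[R]_n | penrose A X].

Definition is_minimum (V : set R) (v : R) : Prop := V v /\ lbound V v.

End MatrixNotions.

Section PowerNetwork.
Context {R : realType} (S : nat).
Implicit Types (M E delta : 'I_S -> R) (X : 'I_S -> 'I_S -> R).

(* M: inertias; E: voltage magnitudes; X n m: effective reactance gamma_nm
   (gamma itself is the damping-to-inertia ratio); delta: equilibrium angles. *)
Definition edge_weight E X delta (n m : 'I_S) : R :=
  E n * E m / X n m * cos (delta n - delta m).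

Definition laplacian E X delta : 'M[R]_S :=
  \matrix_(n, m) (if n == m then \sum_(k | k != n) edge_weight E X delta n k
                  else - edge_weight E X delta n m).

Definition inertia_sqrt M : 'M[R]_S := diag_mx (\row_i Num.sqrt (M i)).

Definition inertia_invsqrt M : 'M[R]_S := diag_mx (\row_i (Num.sqrt (M i))^-1).

Definition scaled_laplacian M E X delta : 'M[R]_S :=
  inertia_invsqrt M *m laplacian E X delta *m inertia_invsqrt M.

Definition ones : 'cV[R]_S := const_mx 1.

Definition u1 M : 'cV[R]_S :=
  (Num.sqrt ((ones^T *m diag_mx (\row_i M i) *m ones) 0 0))^-1
    *: (inertia_sqrt M *m ones).

Definition W M : 'M[R]_S := 1%:M - u1 M *m (u1 M)^T.

(* The modes 2, ..., K+1 are the positions 1, ..., K of the 0-indexed list. *)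
Definition f_y (gamma : R) (K : nat) (A : 'M[R]_S) : R :=
  (2 * gamma)^-1 * \sum_(1 <= i < K.+1) ((eigvals A)`_i)^-1.

Definition sdp_objective (gamma : R) (K : nat) (s : R) (Z : 'M[R]_S) : R :=
  (\tr Z + K%:R * s) / (2 * gamma).

Definition sdp_feasible (A B : 'M[R]_S) (s : R) (Z : 'M[R]_S) : Prop :=
  psd Z /\ psd (block_mx (Z + s%:M) B B A).

Definition sdp_values (gamma : R) (K : nat) (A B : 'M[R]_S) : set R :=
  [set v | exists (s : R) (Z : 'M[R]_S),
     sdp_feasible A B s Z /\ v = sdp_objective gamma K s Z].

End PowerNetwork.

(* Main.v *)
Require Import Defs.
From mathcomp Require Import all_boot all_order all_algebra.
From mathcomp Require Import all_classical all_reals all_analysis.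
From mathcomp Require Import spectral fingroup perm complex ring lra zify.

Set Implicit Arguments.
Unset Strict Implicit.
Unset Printing Implicit Defensive.

Import Order.TTheory GRing.Theory Num.Theory.
Local Open Scope ring_scope.

(** The semidefinite program becomes scalar once it is written in an orthonormal
    eigenbasis p_0, ..., p_(S-1) of L_M, with eigenvalues d_0 <= d_1 <= ....

    The spectrum.  A quadratic form of a Laplacian with positive weights is
    half of the sum of w_ij (x_i - x_j)^2, so it is nonnegative and vanishes
    on constant vectors only; after scaling by the inertias, L_M is positive
    semidefinite and its kernel is the line of the unit vector u_1.  Hence
    d_0 = 0 < d_1, p_0 = u_1 up to sign, and W = I - u_1 u_1^T is the diagonal
    matrix (0, 1, ..., 1) in this basis ([simple_kernel_spectral]).  The
    pseudoinverse is diagonal as well, with entries 0 and 1/d_i, so its K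
    largest eigenvalues are 1/d_1, ..., 1/d_K ([eigvals_pinv_cons],
    [sum_largest_inv]).

    Lower bound ([sdp_lower_bound]).  Testing the block constraint on the vector
    (p_i, -p_i/d_i), i >= 1, gives p_i^T Z p_i + s >= 1/d_i.  Summing over
    i = 1, ..., K, and bounding the sum of the p_i^T Z p_i by the trace of Z
    because Z >= 0, gives Tr Z + K s >= sum of 1/d_i.

    Attainment ([sdp_attained]).  Take s = 1/d_K and Z diagonal in the
    eigenbasis with entries 1/d_i - s for 1 <= i <= K and 0 elsewhere.  Then
    Z + s has entries at least 1/d_i for i >= 1, and the block form splits into
    the forms (z_i + s) a^2 + 2 a b + d_i b^2 >= (a + d_i b)^2 / d_i >= 0.

    An orthonormal eigenbasis of a real symmetric matrix is built in
    [real_spectral]: an eigenvalue comes from the complex spectral theorem for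
    Hermitian matrices, and a Householder reflection splits its eigenvector
    off. *)

(** * Orthogonal diagonalisation of real symmetric matrices *)

Section SpectralTheorem.
Context {R : realType}.

(** Over the complex numbers the matrix is Hermitian, hence unitarily
    diagonalisable with a real spectrum, and a real root of the complexified
    characteristic polynomial is a root of the real one. *)
Lemma symmetric_real_eigenvalue n (A : 'M[R]_n.+1) :
  A^T = A -> exists a, eigenvalue A a.
Proof.
move=> symA; pose Ac : 'M[R[i]]_n.+1 := map_mx (real_complex R) A.
have Ac_herm : Ac \is hermsymmx.
  apply: realsym_hermsym.
    apply/is_hermitianmxP; rewrite expr0 scale1r; apply/matrixP => i j.
    by rewrite !mxE -{1}symA mxE.
  by apply/mxOverP => i j; rewrite mxE; apply/complex_realP; exists (A i j).
set P := spectralmx Ac; set d := spectral_diag Ac.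
have AcE : P *m Ac = diag_mx d *m P.
  have /orthomx_spectralP {1}-> := hermitian_normalmx Ac_herm.
  by rewrite !mulmxA mulmxV ?mul1mx // spectral_unit.
have /mxOverP/(_ 0 0) d_real := hermitian_spectral_diag_real Ac_herm.
have : eigenvalue Ac (d 0 0).
  apply/eigenvalueP; exists (row 0 P).
    by apply/rowP => j; rewrite -row_mul AcE mul_diag_mx !mxE.
  apply/eqP => P0; have := spectral_unit Ac; rewrite -row_free_unit.
  move=> /row_freeP[Q /(congr1 (row 0))]; rewrite row_mul P0 mul0mx.
  by move=> /rowP/(_ 0); rewrite !mxE eqxx => /esym/eqP; rewrite oner_eq0.
have [a ->] : exists a, d 0 0 = real_complex R a.
  by have /complex_realP := d_real.
rewrite eigenvalue_root_char -map_char_poly fmorph_root.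
by rewrite -eigenvalue_root_char; exists a.
Qed.

Lemma dot_eq0 n (x : 'cV[R]_n) : (x^T *m x) 0 0 = 0 -> x = 0.
Proof.
rewrite mxE => /eqP; rewrite psumr_eq0 => [/allP x0|i _]; last first.
  by rewrite mxE -expr2 sqr_ge0.
apply/colP => i; have := x0 i (mem_index_enum i).
by rewrite !mxE /= mulf_eq0 orbb => /eqP.
Qed.

(** The first basis vector e is sent to v by the reflection exchanging them,
    1 - 2 w^T w / |w|^2 with w = e - v.  Since |w|^2 = 2 (1 - c), where c is the
    first entry of v, the coefficient is k = 1 / (1 - c); if v = e, then
    inverting 0 gives k = 0 and the reflection degenerates to the identity. *)
Lemma householder n (v : 'rV[R]_n.+1) :
  v *m v^T = 1%:M -> exists Q : 'M[R]_n.+1, Q *m Q^T = 1%:M /\ row 0 Q = v.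
Proof.
move=> v1; pose e : 'rV[R]_n.+1 := delta_mx 0 0; pose c := v 0 0.
pose w := e - v; pose k := (1 - c)^-1.
have ee : e *m e^T = 1%:M.
  by apply/matrixP => i j; rewrite !ord1 -rowE !mxE eqxx.
have ev : e *m v^T = c%:M.
  by apply/matrixP => i j; rewrite !ord1 -rowE !mxE eqxx.
have ve : v *m e^T = c%:M by rewrite -[LHS]trmxK trmx_mul trmxK ev tr_scalar_mx.
have ew : e *m w^T = (1 - c)%:M.
  by rewrite linearB mulmxBr ee ev raddfB.
have ww : w *m w^T = (2 * (1 - c))%:M.
  rewrite mulmxBl ew linearB mulmxBr ve v1 -!raddfB /=.
  by congr (_%:M); ring.
have w0 : 1 - c = 0 -> w = 0.
  move=> c1; apply: trmx_inj; rewrite trmx0; apply: dot_eq0.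
  by rewrite trmxK ww c1 mulr0 mxE.
pose Q := 1%:M - k *: (w^T *m w).
have QT : Q^T = Q by rewrite linearB linearZ /= trmx_mul trmxK trmx1.
exists Q; split.
  (* This holds for c = 1 too, where k = 0. *)
  have kk : k * (k * (2 * (1 - c))) = 2 * k.
    have [c1|c1] := eqVneq (1 - c) 0; first by rewrite /k c1 invr0; ring.
    by rewrite /k; field.
  rewrite QT mulmxBl mul1mx mulmxBr mulmx1 -scalemxAl -scalemxAr.
  rewrite mulmxA -(mulmxA w^T) ww mul_mx_scalar -scalemxAl !scalerA kk.
  rewrite -[in RHS](subr0 1%:M) -addrA; congr (_ + _).
  by rewrite opprB addrC -addrA -opprD -scalerDl -mulr2n mulr_natl subrr oppr0.
rewrite rowE -/e mulmxBr mulmx1 -scalemxAr mulmxA ew mul_scalar_mx scalerA.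
have [c1|c1] := eqVneq (1 - c) 0.
  have /eqP := w0 c1; rewrite subr_eq0 => /eqP <-.
  by rewrite w0 // scaler0 subr0.
by rewrite mulVf // scale1r subKr.
Qed.

(** Induction on the size: in an orthonormal basis that starts with a unit
    eigenvector, symmetry makes the matrix block diagonal, and the induction
    hypothesis applies to the lower right block. *)
Lemma real_spectral n (A : 'M[R]_n) : A^T = A ->
  exists (P : 'M[R]_n) (d : 'rV[R]_n),
    P *m P^T = 1%:M /\ P *m A *m P^T = diag_mx d.
Proof.
elim: n A => [|n IHn] A symA.
  by exists 1%:M, 0; split; apply/matrixP => -[].
have [a /eigenvalueP[v0 v0A v0_neq0]] := symmetric_real_eigenvalue symA.
have [v [vA v1]] : exists v : 'rV_n.+1, v *m A = a *: v /\ v *m v^T = 1%:M.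
  pose q := (v0 *m v0^T) 0 0.
  have q_gt0 : 0 < q.
    rewrite lt0r; apply/andP; split.
      apply: contra_neq v0_neq0 => q0; apply: trmx_inj; rewrite trmx0.
      by apply: dot_eq0; rewrite trmxK.
    by rewrite /q mxE sumr_ge0 // => i _; rewrite mxE -expr2 sqr_ge0.
  exists ((Num.sqrt q)^-1 *: v0); split.
    by rewrite -scalemxAl v0A !scalerA mulrC.
  rewrite linearZ /= -scalemxAl -scalemxAr scalerA (mx11_scalar (_ *m _)) -/q.
  rewrite scale_scalar_mx -invfM -expr2 sqr_sqrtr ?ltW // mulVf //.
  by rewrite gt_eqF.
have [Q [Q1 rQ]] := householder v1.
pose B : 'M[R]_(1 + n) := Q *m A *m Q^T.
have symB : B^T = B by rewrite /B !trmx_mul trmxK symA mulmxA.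
have rB : row 0 B = a *: delta_mx 0 0.
  by rewrite /B !row_mul rQ vA -scalemxAl -rQ -row_mul Q1 row1.
have BE : B = block_mx a%:M 0 0 (drsubmx B).
  rewrite -[LHS]submxK.
  have ur0 : ursubmx B = 0.
    apply/matrixP => i j; rewrite ord1 !mxE lshift0.
    have /rowP/(_ (rshift 1 j)) := rB; rewrite !mxE => ->.
    by rewrite andbF mulr0.
  have -> : dlsubmx B = 0.
    by rewrite -symB -[LHS]trmxK trmx_dlsub trmxK ur0 trmx0.
  rewrite ur0; congr block_mx; apply/matrixP => i j.
  rewrite !ord1 !mxE lshift0.
  by have /rowP/(_ 0) := rB; rewrite !mxE eqxx mulr1.
have [|P' [d' [P'1 P'd]]] := IHn (drsubmx B).
  by rewrite trmx_drsub symB.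
pose P1 : 'M[R]_(1 + n) := block_mx 1%:M 0 0 P'.
have P1T : P1^T = block_mx 1%:M 0 0 P'^T.
  by rewrite tr_block_mx !trmx0 trmx1.
have P11 : P1 *m P1^T = 1%:M.
  rewrite P1T /P1 mulmx_block.
  by rewrite !(mulmx0, mul0mx, addr0, add0r, mulmx1) P'1 -scalar_mx_block.
have P1B : P1 *m B *m P1^T = diag_mx (row_mx a%:M d').
  rewrite BE P1T /P1 !mulmx_block.
  rewrite !(mulmx0, mul0mx, addr0, add0r, mulmx1, mul1mx).
  rewrite P'd diag_mx_row; congr block_mx.
  by apply/matrixP => i j; rewrite !ord1 !mxE eqxx.
exists (P1 *m Q), (row_mx a%:M d'); split.
  by rewrite trmx_mul mulmxA -(mulmxA P1) Q1 mulmx1.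
by rewrite -P1B trmx_mul !mulmxA.
Qed.

(** The symmetric matrix whose eigenvectors are the rows of P, with eigenvalues
    d.  The matrix L_M, its pseudoinverse, W and the optimal Z all have this
    form, with the same P. *)
Definition diag_conj n (P : 'M[R]_n) (d : 'rV[R]_n) := P^T *m diag_mx d *m P.

(** Permuting the rows of P permutes the eigenvalues, so they can be sorted. *)
Lemma sorted_spectral n (A : 'M[R]_n) : A^T = A ->
  exists (P : 'M[R]_n) (d : 'rV[R]_n),
    [/\ P *m P^T = 1%:M, A = diag_conj P d &
        {homo d 0 : i j / (i <= j)%N >-> i <= j}].
Proof.
move=> /real_spectral[P [d [P1 Pd]]].
pose s := sort <=%R (codom (d 0)).
have s_size : size s = n by rewrite size_sort size_codom card_ord.
have /tuple_permP[p sE] : perm_eq s [tuple d 0 i | i < n].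
  by rewrite perm_sort; exact: perm_refl.
have s_nth i : s`_(nat_of_ord i) = d 0 (p i).
  by rewrite sE (nth_mktuple (fun j => _ (p j))) tnth_mktuple.
pose P2 := perm_mx p *m P.
have P21 : P2 *m P2^T = 1%:M.
  rewrite trmx_mul mulmxA -(mulmxA _ P) P1 mulmx1 tr_perm_mx -perm_mxM.
  by rewrite mulgV perm_mx1.
exists P2, (\row_i d 0 (p i)); split => //.
  have PAP : P2 *m A *m P2^T = diag_mx (\row_i d 0 (p i)).
    have -> : P2 *m A *m P2^T = perm_mx p *m (P *m A *m P^T) *m (perm_mx p)^T.
      by rewrite trmx_mul !mulmxA.
    rewrite Pd tr_perm_mx.
    rewrite -row_permE -col_permE; apply/matrixP => i j.
    by rewrite !mxE (inj_eq perm_inj).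
  rewrite /diag_conj -PAP -[P2 *m A *m _]mulmxA (mulmxA P2^T).
  by rewrite (mulmx1C P21) mul1mx -mulmxA (mulmx1C P21) mulmx1.
move=> i j ij; rewrite !mxE -!s_nth.
have s_sorted : sorted <=%R s by apply: sort_sorted; exact: le_total.
by apply: (sorted_leq_nth le_trans le_refl) => //; rewrite inE s_size.
Qed.

Lemma tr_diag_conj n (P : 'M[R]_n) (d : 'rV[R]_n) :
  (diag_conj P d)^T = diag_conj P d.
Proof. by rewrite !trmx_mul trmxK tr_diag_mx mulmxA. Qed.

Lemma diag_conjM n (P : 'M[R]_n) a b : P *m P^T = 1%:M ->
  diag_conj P a *m diag_conj P b = diag_conj P (\row_i (a 0 i * b 0 i)).
Proof.
move=> P1; rewrite /diag_conj !mulmxA -(mulmxA _ P) P1 mulmx1; congr (_ *m _).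
rewrite -mulmxA; congr (_ *m _); rewrite mul_diag_mx.
by apply/matrixP => i j; rewrite !mxE mulrnAr.
Qed.

Lemma form_diag_conj n (P : 'M[R]_n) (d : 'rV[R]_n) (x y : 'cV[R]_n) :
  (x^T *m diag_conj P d *m y) 0 0 =
  \sum_i d 0 i * (P *m x) i 0 * (P *m y) i 0.
Proof.
rewrite /diag_conj !mulmxA -trmx_mul -mulmxA mxE; apply: eq_bigr => i _.
by rewrite mul_mx_diag !mxE [_ * d 0 i]mulrC.
Qed.

Lemma psd_diag_conj n (P : 'M[R]_n) (z : 'rV[R]_n) :
  (forall i, 0 <= z 0 i) -> psd (diag_conj P z).
Proof.
move=> z_ge0; split; first exact: tr_diag_conj.
move=> x; rewrite form_diag_conj sumr_ge0 // => i _.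
by rewrite -mulrA -expr2 mulr_ge0 // sqr_ge0.
Qed.

Lemma diag_conj_eigvec n (P : 'M[R]_n) (d : 'rV[R]_n) i : P *m P^T = 1%:M ->
  diag_conj P d *m (row i P)^T = d 0 i *: (row i P)^T.
Proof.
move=> P1; apply: trmx_inj.
rewrite trmx_mul tr_diag_conj trmxK linearZ /= trmxK.
rewrite /diag_conj !mulmxA -row_mul P1 row1.
by rewrite -mulmxA -rowE; apply/rowP => j; rewrite mxE mul_diag_mx !mxE.
Qed.

Lemma mxtrace_diag_conj n (P : 'M[R]_n) (d : 'rV[R]_n) : P *m P^T = 1%:M ->
  \tr (diag_conj P d) = \sum_i d 0 i.
Proof. by move=> P1; rewrite mxtrace_mulC mulmxA P1 mul1mx mxtrace_diag. Qed.

Lemma scalar_diag_conj n (P : 'M[R]_n) a : P *m P^T = 1%:M ->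
  a%:M = diag_conj P (const_mx a).
Proof.
move=> P1; rewrite /diag_conj diag_const_mx mul_mx_scalar -scalemxAl.
by rewrite (mulmx1C P1) scalemx1.
Qed.

Lemma char_poly_diag_conj n (P : 'M[R]_n) (d : 'rV[R]_n) : P *m P^T = 1%:M ->
  char_poly (diag_conj P d) = \prod_(x <- codom (d 0)) ('X - x%:P).
Proof.
move=> P1; rewrite big_map enumT.
transitivity (char_poly (diag_mx d)); last first.
  rewrite char_poly_trig ?diag_mx_is_trig //.
  by apply: eq_bigr => i _; rewrite mxE eqxx.
pose Pp := map_mx polyC P.
have Pp1 : Pp^T *m Pp = 1%:M.
  by rewrite map_trmx -map_mxM (mulmx1C P1) map_mx1.
rewrite /char_poly.
have -> : char_poly_mx (diag_conj P d) = Pp^T *m char_poly_mx (diag_mx d) *m Pp.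
  rewrite /char_poly_mx mulmxBr mulmxBl mul_mx_scalar -scalemxAl Pp1 scalemx1.
  by rewrite !map_mxM map_trmx.
by rewrite !det_mulmx mulrAC -det_mulmx Pp1 det1 mul1r.
Qed.

(** The linear factors determine the list of roots up to permutation, and a
    sorted list is determined by its permutation class. *)
Lemma eigvals_diag_conj n (P : 'M[R]_n) (d : 'rV[R]_n) (s : seq R) :
  P *m P^T = 1%:M -> sorted <=%R s -> perm_eq s (codom (d 0)) ->
  eigvals (diag_conj P d) = s.
Proof.
move=> P1 s_sorted s_perm; apply: xget_unique => [|t [t_sorted]].
  by split=> //; rewrite char_poly_diag_conj // -(perm_big _ s_perm).
rewrite char_poly_diag_conj // => /prod_XsubC_eq; rewrite perm_sym => ts.
apply: (sorted_eq le_trans le_anti) => //.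
by rewrite (perm_trans ts) // perm_sym.
Qed.

(** Both A X and A Y are the orthogonal projection onto the range of A, and both
    X A and Y A the one onto the range of A^T; hence X = X A X = Y A Y = Y. *)
Lemma penrose_unique n (A X Y : 'M[R]_n) : penrose A X -> penrose A Y -> X = Y.
Proof.
move=> [AXA XAX AXs XAs] [AYA YAY AYs YAs].
have AXY : A *m X = A *m Y.
  by rewrite -{1}AYA -mulmxA -AXs -AYs -trmx_mul !mulmxA AXA.
have XYA : X *m A = Y *m A.
  by rewrite -{1}AYA !mulmxA -mulmxA -XAs -YAs -trmx_mul -mulmxA (mulmxA A) AXA.
by rewrite -XAX -mulmxA AXY mulmxA XYA YAY.
Qed.

(** Inverting entrywise works for zero eigenvalues too, since the inverse of 0
    is 0: each Penrose identity reduces to a a^-1 a = a. *)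
Lemma mp_pinv_diag_conj n (P : 'M[R]_n) (d : 'rV[R]_n) : P *m P^T = 1%:M ->
  mp_pinv (diag_conj P d) = diag_conj P (\row_i (d 0 i)^-1).
Proof.
move=> P1; set X := RHS.
have divfK0 (a : R) : a * a^-1 * a = a.
  by have [->|a0] := eqVneq a 0; rewrite ?mulr0 // divfK.
have pX : penrose (diag_conj P d) X.
  split; rewrite !diag_conjM ?tr_diag_conj //; congr diag_conj;
    apply/rowP => i; rewrite !mxE ?divfK0 //.
  by have := divfK0 (d 0 i)^-1; rewrite invrK.
by apply: xget_unique => // Y pY; apply: penrose_unique pY pX.
Qed.
End SpectralTheorem.

(** * The inertia-scaled Laplacian *)

Section Laplacian.
Context {R : realType}.

(** The Laplacian of an arbitrary weight function; [laplacian E X delta] is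
    convertible to the one of [edge_weight E X delta]. *)
Definition weighted_laplacian n (w : 'I_n -> 'I_n -> R) : 'M[R]_n :=
  \matrix_(i, j) (if i == j then \sum_(k | k != i) w i k else - w i j).

Lemma weighted_laplacian_mul n (w : 'I_n -> 'I_n -> R) (x : 'cV[R]_n) i :
  (weighted_laplacian w *m x) i 0 = \sum_j w i j * (x i 0 - x j 0).
Proof.
rewrite mxE (bigD1 i) //= mxE eqxx mulr_suml -big_split /= [RHS](bigD1 i) //=.
rewrite subrr mulr0 add0r; apply: eq_bigr => j ji.
by rewrite mxE eq_sym (negPf ji) mulrBr mulNr.
Qed.

(** Exchanging the summation indices in the sum of w_ij x_i (x_i - x_j) turns it
    into the sum of w_ij x_j (x_j - x_i); adding the two gives the squares. *)
Lemma weighted_laplacian_form n (w : 'I_n -> 'I_n -> R) (x : 'cV[R]_n) :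
  (forall i j, w i j = w j i) ->
  2 * (x^T *m weighted_laplacian w *m x) 0 0 =
  \sum_i \sum_j w i j * (x i 0 - x j 0) ^+ 2.
Proof.
move=> w_sym.
have formE : (x^T *m weighted_laplacian w *m x) 0 0 =
    \sum_i \sum_j w i j * x i 0 * (x i 0 - x j 0).
  rewrite -mulmxA mxE; apply: eq_bigr => i _.
  rewrite weighted_laplacian_mul mxE mulr_sumr.
  by apply: eq_bigr => j _; ring.
have formE' : (x^T *m weighted_laplacian w *m x) 0 0 =
    \sum_i \sum_j w i j * x j 0 * (x j 0 - x i 0).
  rewrite formE exchange_big; apply: eq_bigr => i _; apply: eq_bigr => j _.
  by rewrite w_sym.
rewrite mulr_natl mulr2n {1}formE formE' -big_split /=.
apply: eq_bigr => i _; rewrite -big_split; apply: eq_bigr => j _ /=.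
by ring.
Qed.

Lemma weighted_laplacian_ge0 n (w : 'I_n -> 'I_n -> R) (x : 'cV[R]_n) :
  (forall i j, w i j = w j i) -> (forall i j, i != j -> 0 < w i j) ->
  0 <= (x^T *m weighted_laplacian w *m x) 0 0.
Proof.
move=> w_sym w_gt0; rewrite -(pmulr_rge0 _ (ltr0Sn R 1)).
rewrite weighted_laplacian_form //.
apply: sumr_ge0 => i _; apply: sumr_ge0 => j _.
have [->|ij] := eqVneq i j; first by rewrite subrr expr0n mulr0.
by rewrite mulr_ge0 ?sqr_ge0 // ltW // w_gt0.
Qed.

(** Any two indices are joined by an edge of positive weight, so the vanishing
    of all the terms w_ij (x_i - x_j)^2 equates any two entries of x. *)
Lemma weighted_laplacian_eq0 n (w : 'I_n -> 'I_n -> R) (x : 'cV[R]_n) :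
  (forall i j, w i j = w j i) -> (forall i j, i != j -> 0 < w i j) ->
  (x^T *m weighted_laplacian w *m x) 0 0 = 0 -> forall i j, x i 0 = x j 0.
Proof.
move=> w_sym w_gt0 /(congr1 ( *%R 2)).
rewrite weighted_laplacian_form // mulr0 => /eqP.
have term_ge0 i j : 0 <= w i j * (x i 0 - x j 0) ^+ 2.
  have [->|ij] := eqVneq i j; first by rewrite subrr expr0n mulr0.
  by rewrite mulr_ge0 ?sqr_ge0 // ltW // w_gt0.
rewrite psumr_eq0 => [/allP x0 i j|i _]; last exact: sumr_ge0.
have := x0 i (mem_index_enum i); rewrite /= psumr_eq0 //.
move=> /allP/(_ j (mem_index_enum j)); rewrite /= mulf_eq0 sqrf_eq0 subr_eq0.
have [->//|ij] := eqVneq i j.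
by rewrite gt_eqF ?w_gt0 //= => /eqP.
Qed.

Lemma tr_weighted_laplacian n (w : 'I_n -> 'I_n -> R) :
  (forall i j, w i j = w j i) ->
  (weighted_laplacian w)^T = weighted_laplacian w.
Proof.
move=> w_sym; apply/matrixP => i j; rewrite !mxE eq_sym.
by case: eqVneq => [->//|_]; rewrite w_sym.
Qed.

Section Scaled.
Variables (n : nat) (M : 'I_n.+1 -> R) (w : 'I_n.+1 -> 'I_n.+1 -> R).
Hypotheses (M_gt0 : forall i, 0 < M i) (w_sym : forall i j, w i j = w j i).
Hypothesis w_gt0 : forall i j, i != j -> 0 < w i j.
Let D := inertia_invsqrt M.
Let A := D *m weighted_laplacian w *m D.

Lemma invsqrtK : D *m inertia_sqrt M = 1%:M.
Proof.
apply/matrixP => i j; rewrite mul_diag_mx !mxE.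
have [->|_] := eqVneq i j; last by rewrite mulr0.
by rewrite mulr1n mulVf // sqrtr_eq0 -ltNge.
Qed.

Lemma total_inertia_gt0 :
  0 < ((@ones R n.+1)^T *m diag_mx (\row_i M i) *m @ones R n.+1) 0 0.
Proof.
have -> : ((@ones R n.+1)^T *m diag_mx (\row_i M i) *m @ones R n.+1) 0 0
    = \sum_i M i.
  by rewrite mxE; apply: eq_bigr => i _; rewrite mul_mx_diag !mxE mul1r mulr1.
rewrite big_ord_recl ltr_pwDl // sumr_ge0 // => i _; exact: ltW.
Qed.

Lemma u1_unit : (u1 M)^T *m u1 M = 1%:M.
Proof.
rewrite /u1; set m := (_ *m _ *m _) 0 0.
have m_gt0 : 0 < m := total_inertia_gt0.
rewrite [(_ *: _)^T]linearZ /= -scalemxAl -scalemxAr scalerA -invfM -expr2.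
rewrite sqr_sqrtr ?ltW // trmx_mul -mulmxA (mulmxA _ (inertia_sqrt M)).
have -> : (inertia_sqrt M)^T *m inertia_sqrt M = diag_mx (\row_i M i).
  apply/matrixP => i j; rewrite tr_diag_mx mul_diag_mx !mxE mulrnAr -expr2.
  by rewrite sqr_sqrtr // ltW.
rewrite mulmxA [_ *m _]mx11_scalar -/m scale_scalar_mx mulVf //.
by rewrite gt_eqF.
Qed.

Lemma scaled_u1 : A *m u1 M = 0.
Proof.
rewrite /u1 -scalemxAr /A -!mulmxA (mulmxA D _ (@ones R _)) invsqrtK mul1mx.
have -> : weighted_laplacian w *m @ones R n.+1 = 0.
  apply/colP => i; rewrite weighted_laplacian_mul !mxE big1 // => j _.
  by rewrite !mxE subrr mulr0.
by rewrite mulmx0 scaler0.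
Qed.

Lemma tr_scaled : A^T = A.
Proof.
by rewrite !trmx_mul tr_diag_mx tr_weighted_laplacian // mulmxA.
Qed.

Lemma scaled_formE (x : 'cV[R]_n.+1) :
  x^T *m A *m x = (D *m x)^T *m weighted_laplacian w *m (D *m x).
Proof. by rewrite trmx_mul tr_diag_mx !mulmxA. Qed.

Lemma scaled_psd : psd A.
Proof.
split; first exact: tr_scaled.
by move=> x; rewrite scaled_formE weighted_laplacian_ge0.
Qed.

(** If the form vanishes at x, then M^(-1/2) x is constant, so x is a multiple
    of M^(1/2) 1, which is parallel to u_1. *)
Lemma scaled_kernel (x : 'cV[R]_n.+1) :
  (x^T *m A *m x) 0 0 = 0 -> exists c, x = c *: u1 M.
Proof.
rewrite scaled_formE => /(weighted_laplacian_eq0 w_sym w_gt0) Dx.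
pose b := (D *m x) 0 0.
have xE : x = b *: (inertia_sqrt M *m @ones R _).
  rewrite scalemxAr; have -> : b *: @ones R _ = D *m x.
    by apply/colP => i; rewrite (Dx i 0) [LHS]mxE [X in _ * X]mxE mulr1.
  by rewrite mulmxA (mulmx1C invsqrtK) mul1mx.
exists (b * Num.sqrt
  (((@ones R n.+1)^T *m diag_mx (\row_i M i) *m @ones R _) 0 0)).
rewrite /u1 scalerA mulfK // sqrtr_eq0 -ltNge; exact: total_inertia_gt0.
Qed.
End Scaled.

(** All the spectral information on L_M that the program uses.  Each eigenvalue
    is the value of the form at its eigenvector, so an eigenvector of eigenvalue
    0 is plus or minus u; two of them could not be orthogonal. *)
Lemma simple_kernel_spectral n (A : 'M[R]_n.+1) (u : 'cV[R]_n.+1) :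
  psd A -> u^T *m u = 1%:M -> A *m u = 0 ->
  (forall x : 'cV[R]_n.+1, (x^T *m A *m x) 0 0 = 0 -> exists c, x = c *: u) ->
  exists (P : 'M[R]_n.+1) (d : 'rV[R]_n.+1),
    [/\ P *m P^T = 1%:M, A = diag_conj P d,
        {homo d 0 : i j / (i <= j)%N >-> i <= j},
        d 0 0 = 0 /\ (forall i, i != 0 -> 0 < d 0 i) &
        1%:M - u *m u^T = diag_conj P (\row_i (i != 0)%:R)].
Proof.
move=> [symA A_ge0] u1 Au0 A_ker.
have [P [d [P1 AE d_mono]]] := sorted_spectral symA.
have row_dot i j : (row i P *m (row j P)^T) 0 0 = (i == j)%:R.
  have /matrixP/(_ i j) := P1; rewrite !mxE => <-.
  by apply: eq_bigr => k _; rewrite !mxE.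
have rayleigh i : (((row i P)^T)^T *m A *m (row i P)^T) 0 0 = d 0 i.
  rewrite -mulmxA AE diag_conj_eigvec // -scalemxAr trmxK mxE row_dot eqxx.
  by rewrite mulr1.
have d_ge0 i : 0 <= d 0 i by rewrite -rayleigh.
(* An eigenvector of eigenvalue 0 lies on the kernel line, and has norm 1. *)
have d_eq0 i : d 0 i = 0 -> exists2 c, (row i P)^T = c *: u & c ^+ 2 = 1.
  rewrite -{1}rayleigh => /A_ker[c rE]; exists c => //.
  have := row_dot i i; rewrite eqxx -{1}[row i P]trmxK rE.
  rewrite [(_ *: _)^T]linearZ /= -scalemxAl -scalemxAr scalerA u1.
  by rewrite !mxE mulr1 expr2.
have d0 : d 0 0 = 0.
  (* Otherwise A would be injective, although it kills u. *)
  have [i /eqP di0] : exists i, d 0 i == 0.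
    apply/existsP; apply: contraT; rewrite negb_exists => /forallP d_neq0.
    have : u = 0.
      rewrite -[u]mul1mx -(mulmx1C P1) -mulmxA; set v := P *m u.
      suff -> : v = 0 by rewrite mulmx0.
      have dv : diag_mx d *m v = 0.
        rewrite /v -[LHS]mul1mx -P1 -mulmxA (mulmxA P^T) (mulmxA _ P).
        by rewrite -/(diag_conj P d) -AE Au0 mulmx0.
      apply/colP => i; have /colP/(_ i)/eqP := dv.
      by rewrite mul_diag_mx !mxE mulf_eq0 (negPf (d_neq0 i)) => /eqP.
    move=> u0; have /matrixP/(_ 0 0) := u1.
    by rewrite u0 mulmx0 !mxE => /esym/eqP; rewrite oner_eq0.
  by apply/eqP; rewrite eq_le d_ge0 andbT -di0 d_mono.
exists P, d; split => //.
  (* A second zero eigenvalue would put rows 0 and i of P on the same line. *)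
  split=> // i i0; rewrite lt0r d_ge0 andbT; apply/eqP => /d_eq0[c ri c1].
  have [c' r0 c'1] := d_eq0 0 d0.
  have /eqP := row_dot i 0; rewrite (negPf i0) -[row i P]trmxK ri r0.
  rewrite [(c *: u)^T]linearZ /= -scalemxAl -scalemxAr scalerA u1.
  rewrite !mxE mulr1 mulf_eq0.
  move=> /orP[]/eqP z; [move: c1 | move: c'1]; rewrite z expr0n => /esym/eqP;
    by rewrite oner_eq0.
have [c r0 c1] := d_eq0 0 d0.
have -> : u *m u^T = P^T *m delta_mx 0 0 *m P.
  have -> : P^T *m delta_mx 0 0 *m P = (row 0 P)^T *m ((row 0 P)^T)^T.
    rewrite trmxK !rowE trmx_mul trmx_delta.
    by rewrite -(mul_delta_mx (0 : 'I_1)) !mulmxA.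
  rewrite r0 [(c *: u)^T]linearZ /=.
  by rewrite -scalemxAl -scalemxAr scalerA -expr2 c1 scale1r.
rewrite -[X in X - _](mulmx1C P1) -{1}[P^T]mulmx1 -mulmxBl -mulmxBr.
congr (_ *m _ *m _); apply/matrixP => i j; rewrite !mxE.
have [->|ij] := eqVneq i j.
  by case: (j == 0); rewrite /= ?subrr ?subr0.
have [i0|_] := eqVneq i 0; last by rewrite subr0.
by move: ij; rewrite i0 eq_sym => /negPf ->; rewrite subr0.
Qed.
End Laplacian.

(** * The semidefinite program in an eigenbasis *)

Section Sdp.
Context {R : realType}.

Lemma block_form m (a b c e : 'M[R]_m) (x y : 'cV[R]_m) :
  (col_mx x y)^T *m block_mx a b c e *m col_mx x y =
  x^T *m a *m x + x^T *m b *m y + y^T *m c *m x + y^T *m e *m y.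
Proof.
rewrite tr_col_mx mul_row_block mul_row_col !mulmxDl !addrA.
by rewrite -!addrA; congr (_ + _); rewrite addrCA.
Qed.

Lemma big_nat_ord_sub n K (F : nat -> R) : (K <= n)%N ->
  \sum_(1 <= i < K.+1) F i = \sum_(i < n.+1 | (0 < i <= K)%N) F i.
Proof.
move=> Kn; rewrite (big_nat_widen _ _ n.+1) // (big_nat_widenl _ 0) //.
by rewrite big_mkord; apply: eq_bigl => i /=; rewrite ltnS andbC.
Qed.

Section SpectralSdp.
Variables (n K : nat) (P : 'M[R]_n.+1) (d : 'rV[R]_n.+1).
Hypotheses (P1 : P *m P^T = 1%:M) (K_bounds : (1 <= K <= n)%N).
Hypothesis d_mono : {homo d 0 : i j / (i <= j)%N >-> i <= j}.
Hypotheses (d0 : d 0 0 = 0) (d_gt0 : forall i, i != 0 -> 0 < d 0 i).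
Let A := diag_conj P d.
Let B := diag_conj P (\row_i (i != 0)%:R).

Lemma sum_modes_const (s : R) : \sum_(i < n.+1 | (0 < i <= K)%N) s = K%:R * s.
Proof.
have /andP[_ Kn] := K_bounds.
by rewrite -(big_nat_ord_sub (fun=> s)) // sumr_const_nat subSS subn0 mulr_natl.
Qed.

(** For fixed x = p_i, the block form at (x, t x) is p_i^T Z p_i + s + 2 t +
    t^2 d_i, which is smallest at t = -1/d_i; this choice gives the sharpest
    constraint. *)
Lemma sdp_lower_bound s (Z : 'M[R]_n.+1) : sdp_feasible A B s Z ->
  \sum_(i < n.+1 | (0 < i <= K)%N) (d 0 i)^-1 <= \tr Z + K%:R * s.
Proof.
move=> [[_ Z_ge0] [_ blk_ge0]].
pose z i := (row i P *m Z *m (row i P)^T) 0 0.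
have z_ge0 i : 0 <= z i by have := Z_ge0 (row i P)^T; rewrite trmxK.
have trE : \tr Z = \sum_i z i.
  rewrite -[Z in LHS]mulmx1 -(mulmx1C P1) mulmxA mxtrace_mulC.
  apply: eq_bigr => i _; rewrite /z -row_mul mulmxA mxE [RHS]mxE.
  by apply: eq_bigr => k _; rewrite !mxE.
have z_mode (i : 'I_n.+1) : (0 < i)%N -> (d 0 i)^-1 <= z i + s.
  move=> i_gt0; have i0 : i != 0 by rewrite -val_eqE -lt0n.
  have di := d_gt0 i0; pose p := (row i P)^T.
  have pp : p^T *m p = 1%:M.
    apply/matrixP => j k; rewrite !ord1 trmxK.
    have /matrixP/(_ i i) := P1; rewrite !mxE !eqxx => <-.
    by apply: eq_bigr => l _; rewrite !mxE.
  have Ap : A *m p = d 0 i *: p := diag_conj_eigvec d i P1.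
  have Bp : B *m p = p.
    by rewrite /B diag_conj_eigvec // mxE i0 scale1r.
  have Bp' : p^T *m B = p^T by rewrite -[B]tr_diag_conj -trmx_mul Bp.
  pose t := - (d 0 i)^-1.
  have := blk_ge0 (col_mx p (t *: p)).
  rewrite block_form [(t *: p)^T]linearZ /=.
  have -> : p^T *m (Z + s%:M) *m p = p^T *m Z *m p + s%:M.
    by rewrite mulmxDr mulmxDl mul_mx_scalar -scalemxAl pp scalemx1.
  have -> : p^T *m B *m (t *: p) = t%:M by rewrite Bp' -scalemxAr pp scalemx1.
  have -> : t *: p^T *m B *m p = t%:M.
    by rewrite -!scalemxAl Bp' pp scalemx1.
  have -> : t *: p^T *m A *m (t *: p) = (- t)%:M.
    rewrite -!scalemxAl -mulmxA -scalemxAr Ap -!scalemxAr pp !scalemx1.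
    by rewrite !scale_scalar_mx /t; congr (_%:M); field; rewrite gt_eqF.
  rewrite -/(z i) -!addrA -!raddfD mxE /= [p^T]trmxK -/(z i) [_%:M _ _]mxE eqxx.
  by rewrite mulr1n /t; lra.
rewrite trE -sum_modes_const.
rewrite [\sum_i z i](bigID (fun i : 'I_n.+1 => (0 < i <= K)%N)) /=.
rewrite addrAC -big_split /= -[leLHS]addr0 lerD ?sumr_ge0 //.
by apply: ler_sum => i /andP[i_gt0 _]; exact: z_mode.
Qed.

(** In the optimal solution s is the K-th largest eigenvalue of the
    pseudoinverse and Z is the positive part of the excess of the pseudoinverse
    over s. *)
Lemma sdp_attained : exists s (Z : 'M[R]_n.+1), sdp_feasible A B s Z /\
  \tr Z + K%:R * s = \sum_(i < n.+1 | (0 < i <= K)%N) (d 0 i)^-1.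
Proof.
have /andP[K_gt0 Kn] := K_bounds.
pose k : 'I_n.+1 := inord K.
have kE : k = K :> nat by rewrite inordK.
have k0 : k != 0 by rewrite -val_eqE /= kE -lt0n.
pose s := (d 0 k)^-1.
have s_gt0 : 0 < s by rewrite invr_gt0 d_gt0.
pose z : 'rV[R]_n.+1 :=
  \row_i (if (0 < i <= K)%N then (d 0 i)^-1 - s else 0).
have neq0 (j : 'I_n.+1) : (0 < j)%N -> j != 0.
  by rewrite -val_eqE -lt0n.
have z_ge0 i : 0 <= z 0 i.
  rewrite mxE; case: ifP => // /andP[i_gt0 iK].
  rewrite subr_ge0 /s lef_pV2 ?posrE; [| exact: d_gt0 | exact/d_gt0/neq0].
  by apply: d_mono; rewrite kE.
have z_s i : i != 0 -> (d 0 i)^-1 <= z 0 i + s.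
  move=> i0; rewrite mxE; have i_gt0 : (0 < i)%N by rewrite lt0n.
  rewrite i_gt0 /=; case: ifP => [_|/negbT]; first by rewrite subrK.
  rewrite -ltnNge add0r /s => Ki.
  rewrite lef_pV2 ?posrE; [| exact: d_gt0 | exact: d_gt0].
  by apply: d_mono; rewrite kE ltnW.
exists s, (diag_conj P z); split; last first.
  rewrite mxtrace_diag_conj // -sum_modes_const.
  under eq_bigr do rewrite mxE.
  rewrite -big_mkcond -big_split /=.
  by apply: eq_bigr => i _; rewrite subrK.
split; first exact: psd_diag_conj.
have ZsE : diag_conj P z + s%:M = diag_conj P (\row_i (z 0 i + s)).
  rewrite (scalar_diag_conj s P1) /diag_conj -mulmxDl -mulmxDr -raddfD /=.
  by congr (_ *m diag_mx _ *m _); apply/rowP => i; rewrite !mxE.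
rewrite ZsE; split; first by rewrite tr_block_mx !tr_diag_conj.
move=> v; rewrite -(vsubmxK v) block_form; set x := usubmx v; set y := dsubmx v.
rewrite 3!mxE !form_diag_conj -!big_split /= sumr_ge0 // => i _.
set a := (P *m x) i 0; set b := (P *m y) i 0.
rewrite [(\row_j (z 0 j + s)) 0 i]mxE [(\row_j (j != 0)%:R) 0 i]mxE.
have [->|i0] := eqVneq i 0.
  rewrite d0 !mul0r !addr0 -mulrA -expr2 mulr_ge0 ?sqr_ge0 //.
  by rewrite addr_ge0 // ltW.
rewrite /= mulr1n; have di := d_gt0 i0; set q := z 0 i + s.
(* The forms with coordinates a, b decouple; complete the square in b. *)
have -> : q * a * a + 1 * a * b + 1 * b * a + d 0 i * b * b =
  (q - (d 0 i)^-1) * a ^+ 2 + (d 0 i)^-1 * (a + d 0 i * b) ^+ 2.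
  by field; rewrite gt_eqF.
by rewrite addr_ge0 // mulr_ge0 ?sqr_ge0 ?subr_ge0 ?z_s // invr_ge0 ltW.
Qed.

End SpectralSdp.
End Sdp.

(** * Eigenvalues of the pseudoinverse *)

Section Pinv.
Context {R : realType}.

Lemma nth_codom_row n (d : 'rV[R]_n) (i : 'I_n) : (codom (d 0))`_i = d 0 i.
Proof. by rewrite codomE (nth_map i) ?size_enum_ord // nth_ord_enum. Qed.

Lemma sorted_codom n (d : 'rV[R]_n) :
  {homo d 0 : i j / (i <= j)%N >-> i <= j} -> sorted <=%R (codom (d 0)).
Proof.
move=> d_mono; rewrite codomE.
apply: (homo_sorted (e := relpre val leq)) => //.
by rewrite -sorted_map val_enum_ord iota_sorted.
Qed.

(** Inversion reverses the order of the positive eigenvalues, while 0 stays the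
    smallest one. *)
Lemma eigvals_pinv_cons n (P : 'M[R]_n) (d : 'rV[R]_n) (t : seq R) :
  P *m P^T = 1%:M -> codom (d 0) = 0 :: t -> all (> 0) t -> sorted <=%R t ->
  eigvals (mp_pinv (diag_conj P d)) = 0 :: rev [seq x^-1 | x <- t].
Proof.
move=> P1 dE t_gt0 t_sorted.
rewrite mp_pinv_diag_conj //; apply: eigvals_diag_conj => //.
  rewrite /= (path_sortedE le_trans) all_rev rev_sorted all_map.
  apply/andP; split.
    by apply: sub_all t_gt0 => x x_gt0; rewrite /= invr_ge0 ltW.
  rewrite sorted_map; apply: sub_in_sorted t_gt0 t_sorted => x y x_gt0 y_gt0 xy.
  by rewrite /= lef_pV2 ?posrE.
have -> : codom ((\row_i (d 0 i)^-1) 0) = [seq x^-1 | x <- codom (d 0)].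
  by rewrite !codomE -[RHS]map_comp; apply: eq_map => i; rewrite /= mxE.
by rewrite dE /= invr0 perm_cons perm_rev.
Qed.

(** The first K entries of t sit at the positions 1, ..., K after the leading 0,
    and their inverses fill the last K positions once the list is reversed. *)
Lemma sum_largest_inv n K (t : seq R) : size t = n -> (K <= n)%N ->
  \sum_(1 <= i < K.+1) ((0 :: t)`_i)^-1 =
  \sum_(n.+1 - K <= i < n.+1) (0 :: rev [seq x^-1 | x <- t])`_i.
Proof.
move=> t_size Kn; rewrite big_add1 /= big_nat_rev /=.
rewrite -{1}[(n.+1 - K)%N]add0n big_addn subKn ?leqW //.
apply: eq_big_nat => j /andP[_ jK].
have -> : (j + (n.+1 - K) = (j + (n - K)).+1)%N by lia.
rewrite /= nth_rev size_map t_size; last by lia.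
rewrite (nth_map 0); last by rewrite t_size; lia.
by congr (_ `_ _)^-1; lia.
Qed.
End Pinv.

(** * The optimal value *)

Theorem lemma1 (R : realType) (S : nat) (M E delta : 'I_S -> R)
    (X : 'I_S -> 'I_S -> R) (gamma : R) (K : nat)
    (hS : (2 <= S)%N)
    (hM : forall n, 0 < M n)
    (hE : forall n, 0 < E n)
    (hXsym : forall n m, X n m = X m n)
    (hXpos : forall n m, n != m -> 0 < X n m)
    (hdelta : forall n m, n != m -> `|delta n - delta m| < pi / 2)
    (hgamma : 0 < gamma)
    (hK : (1 <= K <= S - 1)%N) :
  let LM := scaled_laplacian M E X delta in
  [/\ (eigvals LM)`_0 = 0 /\ 0 < (eigvals LM)`_1,
      f_y gamma K LM =
        (2 * gamma)^-1 * \sum_(S - K <= i < S) (eigvals (mp_pinv LM))`_i &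
      is_minimum (sdp_values gamma K LM (W M)) (f_y gamma K LM)].
Proof.
case: S => [//|n] in M E delta X hS hM hE hXsym hXpos hdelta hK *.
rewrite subSS subn0 in hK; move=> LM.
pose w := edge_weight E X delta.
have w_sym i j : w i j = w j i.
  by rewrite /w /edge_weight hXsym (mulrC (E i)) -[in LHS]cosN opprB.
have w_gt0 i j : i != j -> 0 < w i j.
  move=> ij; rewrite /w /edge_weight mulr_gt0 ?divr_gt0 ?mulr_gt0 ?hXpos //.
  by rewrite cos_gt0_pihalf // -ltr_norml hdelta.
have [P [d [P1 LME d_mono [d0 d_gt0] WE]]] :
  exists (P : 'M[R]_n.+1) (d : 'rV[R]_n.+1),
    [/\ P *m P^T = 1%:M, LM = diag_conj P d,
        {homo d 0 : i j / (i <= j)%N >-> i <= j},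
        d 0 0 = 0 /\ (forall i, i != 0 -> 0 < d 0 i) &
        W M = diag_conj P (\row_i (i != 0)%:R)].
  apply: simple_kernel_spectral; first exact: scaled_psd w_sym w_gt0.
  - exact: u1_unit.
  - exact: scaled_u1.
  - exact: scaled_kernel.
have eigE : eigvals LM = codom (d 0).
  by rewrite LME; apply: eigvals_diag_conj => //; exact: sorted_codom.
have eig_nth (i : 'I_n.+1) : (eigvals LM)`_i = d 0 i.
  by rewrite eigE nth_codom_row.
have /andP[K_gt0 Kn] := hK.
have fE : f_y gamma K LM =
    (2 * gamma)^-1 * \sum_(i < n.+1 | (0 < i <= K)%N) (d 0 i)^-1.
  rewrite /f_y (big_nat_ord_sub (fun i => ((eigvals LM)`_i)^-1) Kn).
  by congr (_ * _); apply: eq_bigr => i _; rewrite eig_nth.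
split.
- split; first by rewrite (eig_nth 0) d0.
  by rewrite -[1%N]/(val (Ordinal hS)) eig_nth d_gt0.
- pose t := [seq d 0 (lift ord0 j) | j <- enum 'I_n].
  have dE : codom (d 0) = 0 :: t.
    by rewrite codomE enum_ordSl /= -map_comp -[in RHS]d0.
  have t_gt0 : all (> 0) t by apply/allP => _ /mapP[j _ ->]; exact: d_gt0.
  have t_sorted : sorted <=%R t.
    by have := sorted_codom d_mono; rewrite dE => /path_sorted.
  rewrite /f_y eigE LME dE (eigvals_pinv_cons P1 dE) //.
  by rewrite (sum_largest_inv (n := n)) // size_map size_enum_ord.
- have two_gamma : 0 < 2 * gamma by rewrite mulr_gt0.
  split.
    have [s [Z [sZ vE]]] := sdp_attained P1 hK d_mono d0 d_gt0.
    exists s, Z; rewrite WE LME; split => //.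
    by rewrite -LME fE /sdp_objective vE mulrC.
  move=> _ [s [Z [sZ ->]]]; rewrite fE /sdp_objective mulrC.
  rewrite ler_pM2r ?invr_gt0 //.
  by apply: (sdp_lower_bound P1 hK d_gt0); rewrite -LME -WE.
Qed.
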